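(* For every positive integer $n$, the domination polynomial $D(F_n^c,x)$ of the complement $F_n^c$ of the friendship graph $F_n$ has no nonzero real root.
   Context: All graphs are finite, simple and undirected. A set $S\subseteq V(G)$ is a dominating set of $G$ if every vertex of $V(G)\setminus S$ is adjacent to at least one vertex of $S$. Let $d(G,i)$ be the number of dominating sets of $G$ of cardinality $i$ and let $\gamma(G)$ be the minimum cardinality of a dominating set. The domination polynomial of $G$ is $D(G,x)=\sum_{i=\gamma(G)}^{|V(G)|} d(G,i)x^i$. The friendship graph $F_n$ is the graph on $2n+1$ vertices obtained by gluing $n$ copies of the cycle $C_3$ at one common vertex. The complement $G^c$ of $G$ has the same vertex set as $G$, two distinct vertices being adjacent in $G^c$ if and only if they are not adjacent in $G$. *)

(* Defs.v *)
From HB Require Import structures.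
From mathcomp Require Import all_boot all_order all_algebra.

Set Implicit Arguments.
Unset Strict Implicit.
Unset Printing Implicit Defensive.

Import GRing.Theory.
Local Open Scope ring_scope.

Record sgraph := SGraph {
  vertex :> finType;
  adj : rel vertex;
  adj_sym : symmetric adj;
  adj_irrefl : irreflexive adj }.

Arguments adj {G} : rename.

Section Domination.
Variable G : sgraph.

Definition dominating (S : {set G}) : bool :=
  [forall v, (v \notin S) ==> [exists u in S, adj v u]].

Definition num_dominating (i : nat) : nat :=
  #|[set S : {set G} | dominating S & #|S| == i]|.

(* [setT] is dominating, so the minimum is over a nonempty family. *)
Definition domination_number : nat :=
  #|[arg min_(S < [set: G] | dominating S) #|S|]|.

Lemma dominating_setT : dominating [set: G].
Proof. by apply/forallP => v; rewrite in_setT. Qed.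

Definition domination_poly (R : nzRingType) : {poly R} :=
  \sum_(domination_number <= i < #|G|.+1) (num_dominating i)%:R *: 'X^i.

End Domination.

Section Complement.
Variable G : sgraph.

Definition compl_adj : rel G := fun u v => (u != v) && ~~ adj u v.

Fact compl_adj_sym : symmetric compl_adj.
Proof. by move=> u v; rewrite /compl_adj eq_sym adj_sym. Qed.

Fact compl_adj_irrefl : irreflexive compl_adj.
Proof. by move=> u; rewrite /compl_adj eqxx. Qed.

Definition compl_graph : sgraph := SGraph compl_adj_sym compl_adj_irrefl.

End Complement.

Section Friendship.
Variable n : nat.

(* [None] is the common vertex; [Some (i, false)] and [Some (i, true)] are the
   other two vertices of the i-th copy of C_3. *)
Definition friendship_vertex : finType := option ('I_n * bool).

Definition triangle (i : 'I_n) : {set friendship_vertex} :=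
  [set None; Some (i, false); Some (i, true)].

(* C_3 is complete, so the edges of the gluing join the distinct vertices that
   lie in a common copy. *)
Definition friendship_adj : rel friendship_vertex := fun u v =>
  (u != v) && [exists i, (u \in triangle i) && (v \in triangle i)].

Fact friendship_adj_sym : symmetric friendship_adj.
Proof.
move=> u v; rewrite /friendship_adj eq_sym; congr (_ && _).
by apply: eq_existsb => i; rewrite andbC.
Qed.

Fact friendship_adj_irrefl : irreflexive friendship_adj.
Proof. by move=> u; rewrite /friendship_adj eqxx. Qed.

Definition friendship : sgraph :=
  SGraph friendship_adj_sym friendship_adj_irrefl.

Lemma card_friendship : #|friendship| = (2 * n + 1)%N.
Proof. by rewrite card_option card_prod card_ord card_bool mulnC addn1. Qed.

End Friendship.

(* Main.v *)
Require Import Defs.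
From mathcomp Require Import all_boot all_order all_algebra.
From mathcomp Require Import reals.
From mathcomp Require Import ring lra.

(** The common vertex [None] is isolated in the complement of the friendship
    graph, and every other vertex [Some (i, b)] misses there only [None] and
    its mate [Some (i, ~~ b)].  So a set is dominating exactly when it contains
    [None] and is not of the form [{None, w}] ([dominating_compl_friendship]).
    Subtracting the weights of the exceptional sets ([sum_pair_card]) from those
    of all sets through [None] ([sum_mem_card]) gives
      [D(x) = x * ((1 + x) ^ (2 n) - 1 - 2 n x)].
    The second factor is positive for every nonzero real [x]: this is
    Bernoulli's inequality for [(1 + y) ^ n] with [y = 2 x + x ^ 2], where
    [1 + y = (1 + x) ^ 2] is nonnegative whatever the sign of [1 + x]. *)

Import Order.TTheory GRing.Theory Num.Theory.
Local Open Scope ring_scope.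

(** The terms below the domination number vanish, so the lower bound of the
    defining sum is immaterial and the sum can be regrouped by sets. *)
Lemma horner_domination_poly (R : comNzRingType) (G : sgraph) (x : R) :
  (domination_poly G R).[x] = \sum_(S : {set G} | dominating S) x ^+ #|S|.
Proof.
have min_card (S : {set G}) : dominating S -> (domination_number G <= #|S|)%N.
  rewrite /domination_number; case: arg_minnP; first exact: dominating_setT.
  by move=> T _ minT; apply: minT.
rewrite /domination_poly horner_sum.
under eq_bigr do rewrite hornerZ hornerXn.
have -> : \sum_(domination_number G <= i < #|G|.+1)
            (num_dominating G i)%:R * x ^+ i
        = \sum_(0 <= i < #|G|.+1) (num_dominating G i)%:R * x ^+ i.
  have le_num : (domination_number G <= #|G|.+1)%N.
    by rewrite leqW // -cardsT min_card ?dominating_setT.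
  rewrite [RHS](big_cat_nat (leq0n _) le_num) /= [X in X + _]big_nat_cond.
  rewrite [X in X + _]big1 ?add0r //.
  move=> i /andP[/andP[_ lt_i] _]; rewrite /num_dominating.
  suff -> : [set S : {set G} | dominating S & #|S| == i] = set0.
    by rewrite cards0 mul0r.
  apply/setP => S; rewrite !inE; apply/andP => -[domS /eqP cardS].
  by have := min_card S domS; rewrite cardS leqNgt lt_i.
rewrite big_mkord.
rewrite (partition_big (fun S : {set G} => inord #|S| : 'I_#|G|.+1) predT) //=.
apply: eq_bigr => i _; rewrite /num_dominating -sum1dep_card natr_sum mulr_suml.
have inordE (S : {set G}) : (inord #|S| == i :> 'I__) = (#|S| == i).
  by rewrite -val_eqE /= inordK // ltnS max_card.
apply: eq_big => [S|S]; first by rewrite inordE.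
by case/andP => _ /eqP ->; rewrite mul1r.
Qed.

Lemma sum_mem_card (R : comNzRingType) (T : finType) (a : T) (x : R) :
  \sum_(S : {set T} | a \in S) x ^+ #|S| = x * (1 + x) ^+ #|T|.-1.
Proof.
(* Expanding this product chooses x or the second summand at each v; the
   zero summand at a discards the sets that miss a. *)
have <- : \prod_(v : T) (x + (v != a)%:R) = x * (1 + x) ^+ #|T|.-1.
  rewrite (bigD1 a) //= eqxx addr0; congr (_ * _).
  under eq_bigr => v va do rewrite va addrC.
  by rewrite prodr_const -(cardC1 a).
rewrite (bigA_distr 1).
rewrite [RHS](bigID (fun S : {set T} => a \in S)) /= [X in _ = _ + X]big1 ?addr0.
  apply: eq_bigr => S aS; rewrite -prodr_const big_mkcond /=.
  apply: eq_bigr => v _; case: ifPn => // vS.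
  by case: eqP vS => // ->; rewrite aS.
by move=> S aS; rewrite (bigD1 a) //= (negbTE aS) eqxx mul0r.
Qed.

(** Distinct [v] give distinct sets [{a, v}]; the one for [v = a] is a singleton
    and contributes [x], each of the others contributes [x ^ 2]. *)
Lemma sum_pair_card (R : comNzRingType) (T : finType) (a : T) (x : R) :
  \sum_(S in [set [set a; v] | v : T]) x ^+ #|S| =
  x * (1 + x *+ #|T|.-1).
Proof.
have pair_inj : {in T &, injective (fun v => [set a; v])}.
  move=> u v _ _ /setP eq_uv.
  have [//|u_neq_v] := eqVneq u v.
  have := eq_uv u; have := eq_uv v; rewrite !in_set2 !eqxx !orbT.
  rewrite [v == u]eq_sym (negbTE u_neq_v) !orbF => /eqP va /esym /eqP ua.
  by rewrite ua va.
rewrite big_imset //= (bigD1 a) //= cards2 eqxx expr1 mulrDr mulr1; congr (_ + _).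
under eq_bigr => v va do rewrite cards2 eq_sym va.
by rewrite sumr_const cardC1 expr2 mulrnAr.
Qed.

(** No vertex is adjacent to itself, so one that lies in [S] is its own
    non-neighbour and the case distinction on membership in [S] disappears. *)
Lemma dominating_compl (G : sgraph) (S : {set compl_graph G}) :
  dominating S = [forall v : G, [exists u in S, ~~ adj (v : G) u]].
Proof.
apply: eq_forallb => v; apply/implyP/existsP => [domv|[u /andP[uS nvu]] vS].
  have [vS|/domv/existsP[u /and3P[uS _ nvu]]] := boolP (v \in S).
    by exists v; rewrite vS adj_irrefl.
  by exists u; rewrite uS.
apply/existsP; exists u; rewrite uS /= /compl_adj nvu andbT.
by apply: contraNneq vS => ->.
Qed.

Lemma in_triangle n (k : 'I_n) (u : friendship_vertex n) :
  (u \in triangle k) = if u is Some (i, _) then i == k else true.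
Proof.
case: u => [[i b]|]; rewrite !inE //= !(inj_eq Some_inj) !xpair_eqE.
by case: b; rewrite ?andbT ?andbF ?orbF.
Qed.

Lemma friendship_adjE n (u v : friendship n) :
  adj u v =
  match u, v with
  | None, w | w, None => w != None
  | Some (i, b), Some (j, c) => (i == j) && (b == ~~ c)
  end.
Proof.
rewrite /= /friendship_adj; under eq_existsb => k do rewrite !in_triangle.
case: u v => [[i b]|] [[j c]|] //=.
- rewrite (inj_eq Some_inj) xpair_eqE; have [<-|neq_ij] /= := eqVneq i j.
    by case: existsP => [_|[]]; [case: b c => [] []|exists i; rewrite eqxx].
  by apply/existsP => -[k /andP[/eqP <- /eqP ji]]; rewrite ji eqxx in neq_ij.
- by apply/existsP; exists i; rewrite eqxx.
- by apply/existsP; exists j; rewrite eqxx.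
Qed.

(** By [dominating_compl], a set is not dominating when some neighbourhood of
    the friendship graph contains it.  The neighbourhood of [None] consists of
    all other vertices, and that of [Some (i, b)] is [{None, Some (i, ~~ b)}].
    Letting [w] take the value [None] accounts for the singleton [{None}]. *)
Lemma dominating_compl_friendship n (S : {set compl_graph (friendship n)}) :
  (0 < n)%N ->
  dominating S = (None \in S) && (S \notin [set [set None; w] | w : friendship n]).
Proof.
move=> n_gt0; rewrite dominating_compl; apply/forallP/andP.
  move=> nbr; have NS : None \in S.
    by have /existsP[[w|] /andP[uS]] := nbr None; rewrite friendship_adjE.
  split=> //; apply/imsetP => -[[[i b]|] _ defS].
    have /existsP[u /andP[]] := nbr (Some (i, ~~ b)).
    by rewrite defS !inE => /orP[] /eqP->; rewrite friendship_adjE // !eqxx.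
  (* For w = None any vertex other than None has no neighbour in S. *)
  have /existsP[u /andP[]] := nbr (Some (Ordinal n_gt0, false)).
  by rewrite defS !inE orbb => /eqP->; rewrite friendship_adjE.
move=> [NS nimS] [[i b]|]; last by apply/existsP; exists None; rewrite NS adj_irrefl.
apply: contraR nimS => /existsPn adjS; apply/imsetP.
have subS u : u \in S -> u = None \/ u = Some (i, ~~ b).
  move=> uS; have := adjS u; rewrite uS negbK friendship_adjE.
  case: u {uS} => [[j c]|]; last by left.
  by case/andP => /eqP <- /eqP ->; right; rewrite negbK.
have [wS|wS] := boolP (Some (i, ~~ b) \in S);
  [exists (Some (i, ~~ b))|exists None] => //;
  apply/setP => u; rewrite !inE ?orbb; apply/idP/idP.
- by move/subS => [] ->; rewrite eqxx ?orbT.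
- by case/orP => /eqP->.
- by move=> uS; have [->|uw] := subS u uS => //; rewrite -uw uS in wS.
- by move/eqP->.
Qed.

Lemma horner_domination_poly_compl_friendship (R : comNzRingType) n (x : R) :
  (0 < n)%N ->
  (domination_poly (compl_graph (friendship n)) R).[x] =
  x * ((1 + x) ^+ (2 * n) - (1 + x *+ (2 * n))).
Proof.
move=> n_gt0; rewrite horner_domination_poly mulrBr.
have <- : #|friendship n|.-1 = (2 * n)%N by rewrite card_friendship addn1.
rewrite -(sum_mem_card R (friendship n) None) -(sum_pair_card R (friendship n) None).
under eq_bigl => S do rewrite dominating_compl_friendship //.
set pairs := [set [set None; w] | w : friendship n].
rewrite [X in _ = X - _](bigID (fun S => S \in pairs)) /=.
rewrite [X in _ = X + _ - _](eq_bigl (fun S => S \in pairs)).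
  by rewrite [RHS]addrC addKr.
by move=> S /=; rewrite andb_idl // => /imsetP[w _ ->]; rewrite !inE eqxx.
Qed.

(** The step multiplies the bound for [n] by [1 + y], which is nonnegative;
    the discrepancy with the bound for [n + 1] is [n * y ^ 2]. *)
Lemma bernoulli (R : realDomainType) (y : R) n :
  -1 <= y -> 1 + y *+ n <= (1 + y) ^+ n.
Proof.
move=> y_ge; elim: n => [|n IHn]; first by rewrite mulr0n addr0.
rewrite exprS; have y1_ge0 : 0 <= 1 + y by lra.
apply: le_trans (ler_wpM2l y1_ge0 IHn).
rewrite mulrS -(mulr_natr y n) -subr_ge0.
have -> : (1 + y) * (1 + y * n%:R) - (1 + (y + y * n%:R)) = y ^+ 2 * n%:R by ring.
by rewrite mulr_ge0 ?sqr_ge0 ?ler0n.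
Qed.

Theorem theorem8 (R : realType) (n : nat) (n_gt0 : (0 < n)%N) (x : R)
    (x_neq0 : x != 0) :
  ~~ root (domination_poly (compl_graph (friendship n)) R) x.
Proof.
rewrite rootE horner_domination_poly_compl_friendship // mulf_neq0 //.
rewrite subr_eq0 gt_eqF // exprM.
have -> : (1 + x) ^+ 2 = 1 + (x *+ 2 + x ^+ 2) by ring.
have y_ge : -1 <= x *+ 2 + x ^+ 2.
  by rewrite -subr_ge0 (_ : _ - _ = (1 + x) ^+ 2) ?sqr_ge0 //; ring.
apply: lt_le_trans (bernoulli _ _ _ y_ge).
by rewrite mulrnDl -mulrnA addrA ltrDl pmulrn_lgt0 // exprn_even_gt0.
Qed.
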